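(* Let $K$ be a metrizable compact Hausdorff space. Let $\mathcal{A}$ be a closed cone of upper semi-continuous functions $K\to[-\infty,\infty)$ which contains the real constants and strictly separates points of $K$. Then the minimal boundary $m_{\mathcal{A}}$ for $\mathcal{A}$ exists and coincides with the set $P_{\mathcal{A}}$ of all peak points for $\mathcal{A}$; moreover, the Shilov boundary for $\mathcal{A}$ is its closure: $$m_{\mathcal{A}}=P_{\mathcal{A}}\quad\text{and}\quad \check{S}_{\mathcal{A}}=\overline{P}_{\mathcal{A}}.$$
   Context: A function $f:K\to[-\infty,\infty)$ is upper semi-continuous if $\{x\in K: f(x)<c\}$ is open for every $c\in\mathbb{R}$; such a function attains its maximum on $K$. Let $\mathcal{A}$ be a set of such functions. $\mathcal{A}$ is a cone if $af+bg\in\mathcal{A}$ for all $a,b\in[0,+\infty)$ and $f,g\in\mathcal{A}$ (convention: $-\infty\cdot 0=0$). $\mathcal{A}$ is closed if the pointwise limit of every decreasing sequence of functions in $\mathcal{A}$ belongs to $\mathcal{A}$. $\mathcal{A}$ strictly separates points of $K$ if for all distinct $x,y\in K$ there are $f_1,f_2\in\mathcal{A}$ with $f_1(x)>f_1(y)$ and $f_2(x)<f_2(y)$. Put $S(f):=\{x\in K: f(x)=\max_K f\}$. A subset $S\subset K$ is a boundary for $\mathcal{A}$ if $S\cap S(f)\neq\emptyset$ for every $f\in\mathcal{A}$. The Shilov boundary $\check{S}_{\mathcal{A}}$ is the intersection of all closed boundaries for $\mathcal{A}$. The minimal boundary $m_{\mathcal{A}}$, if it exists, is a (not necessarily closed)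 boundary for $\mathcal{A}$ which is contained in every (not necessarily closed) boundary for $\mathcal{A}$. A point $x\in K$ is a peak point for $\mathcal{A}$ if there is $f\in\mathcal{A}$ with $S(f)=\{x\}$. *)

(* Defs.v *)
From HB Require Import structures.
From mathcomp Require Import all_boot all_order all_algebra.
From mathcomp Require Import all_classical all_reals.
From mathcomp Require Import ereal topology normedtype sequences.

Set Implicit Arguments.
Unset Strict Implicit.
Unset Printing Implicit Defensive.

Import Order.TTheory GRing.Theory Num.Theory.
Import numFieldTopology.Exports numFieldNormedType.Exports.

Local Open Scope classical_set_scope.
Local Open Scope ring_scope.
Local Open Scope ereal_scope.

Definition metrizable (R : realType) (K : topologicalType) : Prop :=
  exists d : K -> K -> R,
    [/\ forall x y, (0 <= d x y)%R,
        forall x y, d x y = 0%R <-> x = y,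
        forall x y, d x y = d y x,
        forall x y z, (d x z <= d x y + d y z)%R &
        forall (x : K) (U : set K),
          nbhs x U <-> exists2 e : R, (0 < e)%R & [set y | (d x y < e)%R] `<=` U].

Section Boundaries.
Variables (R : realType) (K : topologicalType).
Implicit Types (f g : K -> \bar R) (A : set (K -> \bar R)) (S : set K).

Definition upper_semicontinuous f : Prop :=
  forall c : R, open [set x | f x < c%:E].

(* Functions K -> [-oo, +oo) are functions K -> \bar R avoiding +oo. *)
Definition usc_fun f : Prop :=
  (forall x, f x < +oo) /\ upper_semicontinuous f.

(* The convention -oo * 0 = 0 is that of multiplication in \bar R. *)
Definition is_cone A : Prop :=
  forall (a b : R) f g, (0 <= a)%R -> (0 <= b)%R -> A f -> A g ->
    A (fun x => a%:E * f x + b%:E * g x).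

Definition closed_decreasing A : Prop :=
  forall (u : nat -> K -> \bar R) f,
    (forall n, A (u n)) ->
    (forall n x, u n.+1 x <= u n x) ->
    (forall x, u n x @[n --> \oo] --> f x) ->
    A f.

Definition contains_constants A : Prop := forall c : R, A (fun=> c%:E).

Definition strictly_separates A : Prop :=
  forall x y : K, x <> y ->
    (exists2 f, A f & f y < f x) /\ (exists2 f, A f & f x < f y).

(* The supremum is a maximum when f is upper semi-continuous and K is compact
   and nonempty. *)
Definition max_set f : set K := [set x | f x = ereal_sup (range f)].

Definition boundary A S : Prop := forall f, A f -> S `&` max_set f !=set0.

Definition shilov_boundary A : set K :=
  \bigcap_(S in [set S | closed S /\ boundary A S]) S.

Definition minimal_boundary A S : Prop :=
  boundary A S /\ forall T, boundary A T -> S `<=` T.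

Definition peak_points A : set K :=
  [set x | exists2 f, A f & max_set f = [set x]].

End Boundaries.

(* Main.v *)
(** Call a nonempty set E a peak set when the function equal to 0 on E and to
    -oo off E lies in A.  If f is in A and m is its maximum, then n (f - m)
    decreases to that function for E = S(f), so every S(f) is a peak set.
    Since such indicators decrease along a decreasing sequence of sets, peak
    sets are stable under decreasing sequential intersections, and a countable
    basis of K yields a minimal peak set E inside any given S(f).  If E had two
    points, a function g of A separating them would give the strictly smaller
    peak set S(g + indicator of E); hence E is a peak point, and the peak points
    form a boundary. *)
Require Import Defs.
From HB Require Import structures.
From mathcomp Require Import all_boot all_order all_algebra.
From mathcomp Require Import all_classical all_reals.
From mathcomp Require Import ereal topology normedtype sequences.
Import Order.TTheory GRing.Theory Num.Theory.
Import numFieldTopology.Exports numFieldNormedType.Exports.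
Local Open Scope classical_set_scope.
Local Open Scope ring_scope.

Set Implicit Arguments.
Unset Strict Implicit.
Unset Printing Implicit Defensive.

(** * Attained maxima and countable bases on compact spaces *)

Lemma ereal_dense (R : realFieldType) (a b : \bar R) :
  (a < b)%E -> exists c : R, (a < c%:E < b)%E.
Proof.
case: a => [a| |]; case: b => [b| |] //.
- rewrite lte_fin => ab; exists ((a + b) / 2).
  by rewrite !lte_fin; have [-> ->] := midf_lt ab.
- by move=> _; exists (a + 1); rewrite lte_fin ltrDl ltr01 ltry.
- by move=> _; exists (b - 1); rewrite lte_fin ltrBlDr ltrDl ltr01 ltNyr.
- by move=> _; exists 0; rewrite ltNyr ltry.
Qed.

(** If the supremum [M] were not attained, the open sets $\{f<c\}$ with real $c<M$ would cover [K].
    They grow with [c], so compactness gives one $c<M$ bounding [f] everywhere. *)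
Lemma max_set_nonempty (R : realType) (K : topologicalType) (f : K -> \bar R) :
  [set: K] !=set0 -> compact [set: K] -> upper_semicontinuous f ->
  max_set f !=set0.
Proof.
move=> [x0 _] /compact_near_coveringP cK uf.
set M := ereal_sup (range f).
have fM x : (f x <= M)%E by apply: ereal_sup_ubound; exists x.
apply: contrapT => noM.
have {}noM x : (f x < M)%E.
  by rewrite lt_neqAle fM andbT; apply/eqP => e; apply: noM; exists x.
(* The filter of reals tending to [M] from below, with base the intervals $[c,M)$; it also covers
   $M=+\infty$. *)
pose D := [set c : R | (c%:E < M)%E].
pose B (c : R) := [set c' : R | c <= c' /\ (c'%:E < M)%E].
have FF : Filter (filter_from D B).
  apply: filter_from_filter.
    by have [c /andP[_ cM]] := ereal_dense (noM x0); exists c.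
  move=> i j Di Dj; exists (Num.max i j).
    by rewrite /D /= /Num.max; case: ifP.
  by move=> c [ijc cM]; move: ijc; rewrite ge_max => /andP[].
have [] := cK R (filter_from D B) (fun c x => (f x < c%:E)%E) FF.
  move=> x _; have [c /andP[xc cM]] := ereal_dense (noM x).
  exists ([set y | (f y < c%:E)%E], B c).
    split; last by exists c.
    by apply: open_nbhs_nbhs; split => //; exact: uf.
  by move=> [y c'] /= [yc [cc' _]]; apply: (lt_le_trans yc); rewrite lee_fin.
move=> c cM /(_ c) cf.
have : (M <= c%:E)%E.
  by apply: ge_ereal_sup => _ [x _ <-]; apply/ltW/cf.
by rewrite leNgt cM.
Qed.

(** Total boundedness: for each [n], finitely many balls of radius $1/(n+1)$ cover [K], and all
    these balls together form the basis. *)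
Lemma metrizable_compact_basis (R : realType) (K : topologicalType) :
  compact [set: K] -> metrizable R K ->
  exists B : set (set K), countable B /\
    forall x (U : set K), nbhs x U -> exists V, [/\ B V, V x & V `<=` U].
Proof.
move=> /compact_near_coveringP cK [d [_ _ dC dT dN]].
pose ball y n := [set z | d y z < n.+1%:R^-1].
have net n : exists s : set K, finite_set s /\
    forall x, exists2 y, s y & ball y n x.
  (* Sets of centres are filtered by containing a given finite set, so the near-covering form of
     compactness returns a finite net. *)
  pose Fs := filter_from (@finite_set K) (fun s => [set t | s `<=` t]).
  have FF : Filter Fs.
    apply: filter_from_filter; first by exists set0.
    move=> s t fs ft; exists (s `|` t); first by rewrite /= finite_setU.
    by move=> u stu; split=> y ?; apply: stu; [left|right].
  have [] := cK _ Fs (fun s x => exists2 y, s y & ball y n x) FF.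
    move=> x _; exists (ball x n, [set t | [set x] `<=` t]).
      split; first by apply/dN; exists n.+1%:R^-1 => //; rewrite invr_gt0.
      by exists [set x].
    by move=> [z t] /= [xz xt]; exists x => //; exact: xt.
  move=> s fs /(_ s (@subset_refl _ s)) cs.
  by exists s; split => // x; exact: cs.
have [s hs] := choice net.
exists (\bigcup_n [set ball y n | y in s n]); split.
  apply: bigcup_countable => // n _.
  by apply/finite_set_countable/finite_image; case: (hs n).
move=> x U /dN[e e0 eU].
(* Radius below $e/2$: any two points of one ball are then closer than [e]. *)
have [n _ /(_ n (leqnn n)) ne] :=
  near_infty_natSinv_lt (PosNum (divr_gt0 e0 (ltr0Sn R 1))).
have [_ /(_ x)[y sy yx]] := hs n.
exists (ball y n); split => //; first by exists n => //; exists y.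
move=> z yz; apply: eU => /=; apply: (le_lt_trans (dT x y z)).
by rewrite (splitr e) dC; apply: ltrD;
  [apply: lt_trans yx _ | apply: lt_trans yz _].
Qed.

(** * Indicators with values 0 and $-\infty$ *)

Definition ind0 (R : realType) (K : Type) (E : set K) (x : K) : \bar R :=
  if x \in E then 0%E else -oo%E.
Arguments ind0 R {K} E x.

Lemma ind0_max_set (R : realType) (K : topologicalType) (A : set (K -> \bar R))
    (f : K -> \bar R) :
  [set: K] !=set0 -> compact [set: K] ->
  (forall f, A f -> usc_fun f) -> is_cone A -> closed_decreasing A ->
  contains_constants A -> A f -> A (ind0 R (max_set f)).
Proof.
move=> K0 cK uA cA dA constA Af.
have [fy uf] := uA _ Af.
have [x0 fx0] := max_set_nonempty K0 cK uf.
have fle x : (f x <= f x0)%E.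
  by rewrite fx0; apply: ereal_sup_ubound; exists x.
have indE x : ind0 R (max_set f) x = if f x == f x0 then 0%E else -oo%E.
  rewrite /ind0; congr (if _ then _ else _); apply/idP/eqP.
    by rewrite inE => ->; rewrite fx0.
  by rewrite inE /max_set /= => ->; rewrite -fx0.
(* A maximum of $-\infty$ forces [f] to be constant, and the indicator is then the constant 0. *)
case fx0E : (f x0) (fy x0) fle => [m| |] // _ fle; last first.
  rewrite (_ : ind0 R _ = fun=> 0%:E); first exact: constA.
  apply/funext => x; rewrite indE fx0E; case: eqP => // nx.
  by case: nx; apply/eqP; rewrite -leeNy_eq.
(* The factor $n+1$ is never zero, so the value $-\infty$ persists at every index. The sign of $-m$
   sits in the constant function, as cone coefficients are nonnegative. *)
pose u n x := (n.+1%:R%:E * f x + n.+1%:R%:E * (- m)%:E)%E.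
apply: (dA u) => [n | n x | x]; first by apply: cA => //; exact: constA.
- rewrite /u; case fxE : (f x) (fy x) (fle x) => [r| |] // _.
    rewrite -!EFinM -!EFinD !lee_fin -!mulrDr => rm.
    by rewrite ler_wnM2r ?subr_le0 ?ler_nat.
  by move=> _; rewrite !gt0_muleNy ?lte_fin ?ltr0Sn.
- rewrite indE fx0E /u.
  case fxE : (f x) (fy x) (fle x) => [r| |] // _; last first.
    move=> _; apply: cvg_near_cst; apply: nearW => n.
    by rewrite gt0_muleNy ?lte_fin ?ltr0Sn.
  rewrite lee_fin => rm; have [[->]|nrm] := eqP.
    apply: cvg_near_cst; apply: nearW => n.
    by rewrite -!EFinM -!EFinD -mulrDr subrr mulr0.
  have {}rm : r < m.
    by rewrite lt_neqAle rm andbT; apply/eqP => e; apply: nrm; rewrite e.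
  (* Since $r-m<0$, having $n\ge a/(r-m)$ gives $(n+1)(r-m)\le a$. *)
  apply/cvgeNyPle => a; have [N _ hN] := nbhs_infty_ger (a / (r - m)).
  exists N => // n Nn; rewrite -!EFinM -!EFinD lee_fin -!mulrDr.
  rewrite -ler_ndivrMr ?subr_lt0 //; apply: (le_trans (hN _ Nn)).
  by rewrite ler_nat.
Qed.

Lemma decreasing_sets (K : Type) (E : nat -> set K) :
  (forall n, E n.+1 `<=` E n) -> forall m n, (m <= n)%N -> E n `<=` E m.
Proof.
move=> Edec m; elim=> [|n IH]; first by rewrite leqn0 => /eqP ->.
rewrite leq_eqVlt => /predU1P[-> //|]; rewrite ltnS => /IH mn.
exact: subset_trans (Edec n) mn.
Qed.

Lemma ind0_bigcap (R : realType) (K : topologicalType) (A : set (K -> \bar R))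
    (E : nat -> set K) :
  closed_decreasing A -> (forall n, E n.+1 `<=` E n) ->
  (forall n, A (ind0 R (E n))) -> A (ind0 R (\bigcap_n E n)).
Proof.
move=> dA Edec AE.
have Emono := decreasing_sets Edec.
apply: (dA (fun n => ind0 R (E n))) => // [n x|x]; rewrite /ind0.
  case: ifPn => [|_]; last exact: leNye.
  by rewrite inE => /Edec xn; rewrite mem_set.
apply: cvg_near_cst; have [xE|xE] := pselect ((\bigcap_n E n) x).
  by apply: nearW => n; rewrite !mem_set //; exact: xE.
have [k xk] : exists k, ~ E k x.
  by apply: contrapT => nk; apply: xE => n _; apply: contrapT => xn;
    apply: nk; exists n.
by exists k => // n kn; rewrite !memNset // => /(Emono _ _ kn).
Qed.

Lemma closed_ind0 (R : realType) (K : topologicalType) (E : set K) :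
  upper_semicontinuous (ind0 R E) -> closed E.
Proof.
move=> /(_ 0); rewrite (_ : [set x | _] = ~` E) ?openC //.
apply/seteqP; split => x; rewrite /ind0 /=.
  by case: ifPn; rewrite ?ltxx // notin_setE.
by move=> nx; rewrite memNset // ltNyr.
Qed.

(** Cantor's intersection argument: otherwise the complements form an increasing open cover, and one
    of them is all of [K]. *)
Lemma nested_nonempty (K : topologicalType) (E : nat -> set K) :
  compact [set: K] -> (forall n, closed (E n)) -> (forall n, E n !=set0) ->
  (forall n, E n.+1 `<=` E n) -> \bigcap_n E n !=set0.
Proof.
move=> /compact_near_coveringP cK clE E0 Edec; apply: contrapT => noE.
have Emono := decreasing_sets Edec.
have [] := cK nat \oo (fun n x => ~ E n x) _.
  move=> x _; have [k xk] : exists k, ~ E k x.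
    apply: contrapT => nk; apply: noE; exists x => n _.
    by apply: contrapT => xn; apply: nk; exists n.
  exists (~` E k, [set n | (k <= n)%N]).
    split; last by exists k.
    by apply: open_nbhs_nbhs; split => //; rewrite openC.
  by move=> [z n] /= [zk kn] /(Emono _ _ kn).
by move=> n _ /(_ n (leqnn n)) nE; have [x /(nE x I)] := E0 n.
Qed.

(** * Minimal peak sets *)

Definition peak_set (R : realType) (K : topologicalType) (A : set (K -> \bar R))
  (E : set K) : Prop := A (ind0 R E) /\ E !=set0.

(** A greedy construction in place of Zorn's lemma: stage [k] shrinks the current peak set to one
    missing the basis element numbered [k], whenever such a peak subset exists. *)
Lemma minimal_peak_set (R : realType) (K : topologicalType)
    (A : set (K -> \bar R)) (E0 : set K) :
  compact [set: K] -> metrizable R K ->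
  (forall f, A f -> usc_fun f) -> closed_decreasing A -> peak_set A E0 ->
  exists E, [/\ peak_set A E, E `<=` E0 &
    forall E', peak_set A E' -> E' `<=` E -> E `<=` E'].
Proof.
move=> cK mK uA dA pE0.
have clA E : peak_set A E -> closed E.
  by move=> [/uA[_ uE] _]; exact: closed_ind0 uE.
have [B [/countable_injP[g ginj] basis]] := metrizable_compact_basis cK mK.
pose avoids (k : nat) (E : set K) :=
  exists U, [/\ B U, g U = k & E `&` U = set0].
(* The hypothesis on [p.2] stands under the existential so that [choice] yields a total function. *)
have step (p : nat * set K) : exists E, peak_set A p.2 ->
    [/\ peak_set A E, E `<=` p.2 &
      forall E', peak_set A E' -> E' `<=` p.2 -> avoids p.1 E' ->
        avoids p.1 E].
  have [[E [pE Ep aE]]|no] :=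
      pselect (exists E, [/\ peak_set A E, E `<=` p.2 & avoids p.1 E]).
    by exists E.
  exists p.2 => pp; split => // E' pE' E'p aE'.
  by case: no; exists E'.
have {step} [next nextP] := choice step.
pose E := fix E n := if n is n'.+1 then next (n', E n') else E0.
have pE n : peak_set A (E n).
  by elim: n => //= n IH; have [] := nextP (n, E n) IH.
have Edec n : E n.+1 `<=` E n by have [] := nextP (n, E n) (pE n).
have sub n : \bigcap_n E n `<=` E n by move=> x; exact.
exists (\bigcap_n E n); split; last first.
- move=> E' pE' E'E x xE; apply: contrapT => xE'.
  have [U [BU Ux UE']] : exists V, [/\ B V, V x & V `<=` ~` E'].
    apply: basis; apply: open_nbhs_nbhs; split => //.
    by rewrite openC; exact: clA.
  (* At stage [g U] the set [E'] was a candidate missing [U], so the next set misses [U] as well,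
     although it contains [x]. *)
  have [_ _ /(_ E' pE' _ _)[]] := nextP (g U, E (g U)) (pE _).
  + exact: subset_trans E'E (sub _).
  + exists U; split => //; apply/seteqP; split => // y [yE' /UE']; exact.
  + move=> V [BV gV EV]; have VU : V = U by apply: ginj; rewrite ?inE.
    suff : set0 x by [].
    by rewrite -EV VU; split => //; exact: (xE (g U).+1).
- exact: sub 0%N.
- split; first by apply: ind0_bigcap => // n; case: (pE n).
  apply: nested_nonempty => // n; first exact: clA.
  by case: (pE n).
Qed.

Lemma minimal_peak_set_singleton (R : realType) (K : topologicalType)
    (A : set (K -> \bar R)) (E : set K) :
  [set: K] !=set0 -> compact [set: K] ->
  (forall f, A f -> usc_fun f) -> is_cone A -> closed_decreasing A ->
  contains_constants A -> strictly_separates A -> peak_set A E ->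
  (forall E', peak_set A E' -> E' `<=` E -> E `<=` E') ->
  exists x, E = [set x].
Proof.
move=> K0 cK uA cA dA constA sepA [AE [x Ex]] minE.
exists x; apply/seteqP; split => [y Ey|_ -> //]; apply: contrapT => yx.
have [[f Af fyx] _] := sepA _ _ (nesym yx).
(* Adding the indicator keeps [f] on [E] and puts $-\infty$ elsewhere, so [h] is maximal only inside
   [E]. *)
pose h z := (1%:E * f z + 1%:E * ind0 R E z)%E.
have Ah : A h by apply: cA.
have hE z : E z -> h z = f z.
  by move=> zE; rewrite /h /ind0 mem_set // mule0 adde0 mul1e.
have hsup : (f x <= ereal_sup (range h))%E.
  by rewrite -hE //; apply: ereal_sup_ubound; exists x.
have /minE : peak_set A (max_set h).
  by split; [exact: ind0_max_set |
    apply: max_set_nonempty => //; case: (uA _ Ah)].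
have sub : max_set h `<=` E.
  move=> z hz; apply: contrapT => zE; suff : (f x <= -oo)%E.
    by rewrite leNgt (le_lt_trans (leNye _) fyx).
  apply: (le_trans hsup); rewrite -hz /h /ind0 memNset //.
  by rewrite mul1e mul1e addeNy.
(* Minimality would make [y] a maximum point of [h], but $h(y)=f(y)<f(x)\le\sup h$. *)
by move=> /(_ sub y Ey); rewrite /max_set /= hE // => fy; move: fyx;
  rewrite ltNge fy hsup.
Qed.

(** * Peak points and boundaries *)

Lemma peak_points_boundary (R : realType) (K : topologicalType)
    (A : set (K -> \bar R)) :
  [set: K] !=set0 -> compact [set: K] -> metrizable R K ->
  (forall f, A f -> usc_fun f) -> is_cone A -> closed_decreasing A ->
  contains_constants A -> strictly_separates A -> boundary A (peak_points A).
Proof.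
move=> K0 cK mK uA cA dA constA sepA f Af.
have pf : peak_set A (max_set f).
  by split; [exact: ind0_max_set |
    apply: max_set_nonempty => //; case: (uA _ Af)].
have [E [pE Ef minE]] := minimal_peak_set cK mK uA dA pf.
have [x Ex] := minimal_peak_set_singleton K0 cK uA cA dA constA sepA pE minE.
exists x; split; last by apply: Ef; rewrite Ex.
(* The indicator of $E=\{x\}$ is itself a function peaking exactly at [x]. *)
exists (ind0 R E); first by case: pE.
have indx : ind0 R E x = 0%E by rewrite /ind0 mem_set // Ex.
have sup0 : ereal_sup (range (ind0 R E)) = 0%E.
  apply/eqP; rewrite eq_le; apply/andP; split.
    by apply: ge_ereal_sup => _ [z _ <-]; rewrite /ind0; case: ifP => // _;
      rewrite leNye.
  by apply: ereal_sup_ubound; exists x.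
rewrite -[in RHS]Ex; apply/seteqP; split => z; rewrite /max_set /= sup0 /ind0.
  by case: ifPn => // /set_mem.
by move=> Ez; rewrite mem_set.
Qed.

(** A boundary must meet $S(f)=\{x\}$, which it can do only at [x]. *)
Lemma peak_points_sub_boundary (R : realType) (K : topologicalType)
    (A : set (K -> \bar R)) (T : set K) :
  boundary A T -> peak_points A `<=` T.
Proof.
by move=> bT x [f Af fx]; have [y [Ty]] := bT f Af; rewrite fx => <-.
Qed.

Theorem theorem3p8 (R : realType) (K : topologicalType)
    (K_nonempty : [set: K] !=set0)
    (K_compact : compact [set: K])
    (K_hausdorff : hausdorff_space K)
    (K_metrizable : metrizable R K)
    (A : set (K -> \bar R))
    (A_usc : forall f, A f -> usc_fun f)
    (A_cone : is_cone A)
    (A_closed : closed_decreasing A)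
    (A_constants : contains_constants A)
    (A_separates : strictly_separates A) :
  [/\ exists M : set K, minimal_boundary A M,
      forall M : set K, minimal_boundary A M -> M = peak_points A &
      shilov_boundary A = closure (peak_points A)].
Proof.
have bP : boundary A (peak_points A) by exact: peak_points_boundary.
split.
- by exists (peak_points A); split => // T; exact: peak_points_sub_boundary.
- move=> M [bM minM]; apply/seteqP; split; first exact: minM.
  exact: peak_points_sub_boundary.
- apply/seteqP; split.
    (* The closure of the peak points is one of the closed boundaries being intersected. *)
    move=> x; apply; split; first exact: closed_closure.
    move=> f /bP[y [Py fy]]; exists y; split => //; exact: subset_closure.
  move=> x Px T [/closure_id clT bT].
  by rewrite clT; apply: closureS Px; exact: peak_points_sub_boundary.
Qed.
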